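(* Let $\mathbb{K}$ be an algebraically closed field of characteristic zero and let $\mathfrak{g}$ be a finite-dimensional Lie algebra over $\mathbb{K}$ whose second scalar cohomology group $\mathbf{H}^2_{CE}(\mathfrak{g},\mathbb{K})$ is nonzero. Then $\mathfrak{g}$ is not strongly rigid.
   Context: $\mathbf{H}^2_{CE}(\mathfrak{g},\mathbb{K})$ is Chevalley–Eilenberg cohomology with values in the trivial module $\mathbb{K}$. A formal associative deformation of an associative $\mathbb{K}$-algebra $(\mathcal{A},\mu_0)$ is an associative $\mathbb{K}[[t]]$-bilinear product $\mu_t=\mu_0+t\mu_1+t^2\mu_2+\cdots$ on $\mathcal{A}[[t]]$ with $\mu_r\in\mathrm{Hom}_{\mathbb{K}}(\mathcal{A}\otimes\mathcal{A},\mathcal{A})$; it is trivial if there is $\varphi_t=\mathrm{Id}+t\varphi_1+t^2\varphi_2+\cdots$ with $\varphi_r\in\mathrm{Hom}_{\mathbb{K}}(\mathcal{A},\mathcal{A})$ and $\varphi_t(\mu_t(a,b))=\mu_0(\varphi_t(a),\varphi_t(b))$. The algebra $\mathcal{A}$ is rigid if every formal associative deformation is trivial. A Lie algebra $\mathfrak{g}$ is strongly rigid if its universal enveloping algebra $\mathcal{U}\mathfrak{g}$ is rigid as an associative algebra. *)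

(* Defs.v *)
From HB Require Import structures.
From mathcomp Require Import all_boot all_order all_algebra.
From mathcomp Require Import boolp.
From mathcomp Require Import finmap monalg.

Set Implicit Arguments.
Unset Strict Implicit.
Unset Printing Implicit Defensive.

Import GRing.Theory.
Local Open Scope ring_scope.
Local Open Scope quotient_scope.

HB.mixin Record Lmodule_isLieAlgebra (K : fieldType) g of GRing.Lmodule K g := {
  lie : g -> g -> g;
  lie_linearl : forall z, linear (lie ^~ z);
  lie_linearr : forall z, linear (lie z);
  lie_alt : forall x, lie x x = 0;
  lie_jacobi : forall x y z,
    lie x (lie y z) + lie y (lie z x) + lie z (lie x y) = 0
}.

#[short(type="lieAlgType")]
HB.structure Definition LieAlgebra (K : fieldType) :=
  { g of GRing.Lmodule K g & Lmodule_isLieAlgebra K g }.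

#[short(type="finLieAlgType")]
HB.structure Definition FinLieAlgebra (K : fieldType) :=
  { g of Vector K g & Lmodule_isLieAlgebra K g }.

Section ChevalleyEilenberg.
Variables (K : fieldType) (g : lieAlgType K).

HB.instance Definition _ (x : g) :=
  GRing.isLinear.Build K g g *:%R (lie x) (lie_linearr x).

Lemma lieC (x y : g) : lie x y = - lie y x.
Proof.
have lieDl (p q r : g) : lie (p + q) r = lie p r + lie q r.
  by have := lie_linearl r 1 p q; rewrite !scale1r.
apply/eqP; rewrite -addr_eq0; apply/eqP; have := lie_alt (x + y).
by rewrite lieDl !linearD /= !lie_alt add0r addr0.
Qed.

Definition is_cochain1 (a : g -> K) : Prop := scalar a.

Definition is_cochain2 (w : g -> g -> K) : Prop :=
  [/\ forall z, scalar (w ^~ z), forall z, scalar (w z) & forall x, w x x = 0].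

(* With values in the trivial module, the Chevalley-Eilenberg differential is
   (d c)(x_0, ..., x_k) =
     \sum_(i < j) (-1)^(i+j) c([x_i, x_j], x_0, .., ^x_i, .., ^x_j, .., x_k). *)
Definition ce_d1 (a : g -> K) (x y : g) : K := - a (lie x y).

Definition ce_d2 (w : g -> g -> K) (x y z : g) : K :=
  - w (lie x y) z + w (lie x z) y - w (lie y z) x.

Definition is_cocycle2 (w : g -> g -> K) : Prop :=
  is_cochain2 w /\ forall x y z, ce_d2 w x y z = 0.

Definition is_coboundary2 (w : g -> g -> K) : Prop :=
  exists2 a, is_cochain1 a & forall x y, w x y = ce_d1 a x y.

Lemma coboundary2_cocycle w : is_coboundary2 w -> is_cocycle2 w.
Proof.
case=> a alin wE.
pose aL : {scalar g} := HB.pack a (GRing.isLinear.Build K g K *%R a alin).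
have aD x y : a (x + y) = a x + a y by exact: (linearD aL).
have aN x : a (- x) = - a x by exact: (linearN aL).
have a0 : a 0 = 0 by exact: (linear0 aL).
split.
  split=> [z k x y|z k x y|x]; rewrite !wE /ce_d1.
  - by rewrite lie_linearl alin opprD mulrN.
  - by rewrite lie_linearr alin opprD mulrN.
  - by rewrite lie_alt a0 oppr0.
move=> x y z; apply/eqP; rewrite -oppr_eq0 /ce_d2 !wE /ce_d1 !opprK; apply/eqP.
rewrite -a0 -(lie_jacobi x y z) !aD (lieC z x) linearN aN /=.
rewrite (lieC (lie x y) z) (lieC (lie x z) y) (lieC (lie y z) x) !aN !opprK.
by rewrite !opprD !opprK addrC addrA addrAC.
Qed.

(* Nonvanishing of the quotient of the space of 2-cocycles by its subspace of
   2-coboundaries. *)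
Definition ce_H2_nonzero : Prop :=
  exists2 w, is_cocycle2 w & ~ is_coboundary2 w.

End ChevalleyEilenberg.

Section FormalDeformation.
Variables (K : fieldType) (A : algType K).

(* An element of A[[t]] is given by its sequence of coefficients.  A
   K[[t]]-bilinear product mu_0 + t mu_1 + ... on A[[t]] is given by the
   sequence of the K-bilinear maps mu_r. *)
Definition fps_mul (mu : nat -> A -> A -> A) (a b : nat -> A) : nat -> A :=
  fun n => \sum_(r < n.+1) \sum_(i < (n - r).+1) mu r (a i) (b (n - r - i)%N).

Definition fps_app (phi : nat -> A -> A) (a : nat -> A) : nat -> A :=
  fun n => \sum_(r < n.+1) phi r (a (n - r)%N).

(* The undeformed product mu_0, extended K[[t]]-bilinearly to A[[t]]. *)
Definition fps_mul0 (a b : nat -> A) : nat -> A :=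
  fun n => \sum_(i < n.+1) a i * b (n - i)%N.

Definition formal_deformation (mu : nat -> A -> A -> A) : Prop :=
  [/\ forall r b, linear (mu r ^~ b),
      forall r a, linear (mu r a),
      forall a b, mu 0%N a b = a * b &
      forall a b c : nat -> A,
        fps_mul mu (fps_mul mu a b) c =1 fps_mul mu a (fps_mul mu b c)].

Definition trivial_deformation (mu : nat -> A -> A -> A) : Prop :=
  exists phi : nat -> A -> A,
    [/\ forall r, linear (phi r),
        forall a, phi 0%N a = a &
        forall a b : nat -> A,
          fps_app phi (fps_mul mu a b)
            =1 fps_mul0 (fps_app phi a) (fps_app phi b)].

Definition rigid : Prop :=
  forall mu, formal_deformation mu -> trivial_deformation mu.

End FormalDeformation.

Section Enveloping.
Variables (K : fieldType) (g : lieAlgType K).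

(* The free associative unital K-algebra on the set g. *)
Local Notation F := {malg K[{fmonom g}]}.

Definition free_gen (x : g) : F := << fmu x >>.

(* The two-sided ideal generated by the relations making free_gen linear (the
   quotient by these alone is the tensor algebra of g) and by the relations
   x y - y x - [x, y]. *)
Inductive env_ideal : F -> Prop :=
| env_ideal_linear k x y :
    env_ideal (free_gen (k *: x + y) - (k *: free_gen x + free_gen y))
| env_ideal_lie x y :
    env_ideal (free_gen x * free_gen y - free_gen y * free_gen x
               - free_gen (lie x y))
| env_ideal0 : env_ideal 0
| env_idealD u v : env_ideal u -> env_ideal v -> env_ideal (u + v)
| env_idealMl u v : env_ideal v -> env_ideal (u * v)
| env_idealMr u v : env_ideal u -> env_ideal (u * v).

Lemma free_scaleAr k (u v : F) : k *: (u * v) = u * (k *: v).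
Proof.
apply/malgP => w; rewrite mcoeffZ mcoeffMl.
rewrite (mcoeffMlw w (fsubset_refl _) (msuppZ_le k v)) mulr_sumr.
apply: eq_bigr => i _; rewrite mulr_sumr; apply: eq_bigr => j _.
by rewrite mcoeffZ mulrnAr mulrCA.
Qed.

Lemma env_idealZ k u : env_ideal u -> env_ideal (k *: u).
Proof. by rewrite -mul_malgC => /env_idealMl. Qed.

Lemma env_idealN u : env_ideal u -> env_ideal (- u).
Proof. by rewrite -scaleN1r => /env_idealZ. Qed.

Lemma env_ideal_proper u : env_ideal u -> mcoeff mone u = 0.
Proof.
have e1 x : mcoeff mone (free_gen x) = 0.
  by rewrite mcoeffU -[_ == mone]val_eqE /= fmU fm1.
elim=> [k x y|x y||{}u v _ u0 _ v0|{}u v _ v0|{}u v _ u0].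
- by rewrite !(mcoeffB, mcoeffD, mcoeffZ) !e1 mulr0 addr0 subr0.
- by rewrite !mcoeffB !rmorphM /= !e1 !mulr0 !subr0.
- by rewrite mcoeff0.
- by rewrite mcoeffD u0 v0 addr0.
- by rewrite rmorphM /= v0 mulr0.
- by rewrite rmorphM /= u0 mul0r.
Qed.

Definition env_eq (u v : F) : bool := `[< env_ideal (u - v) >].

Lemma env_eqP u v : reflect (env_ideal (u - v)) (env_eq u v).
Proof. exact: asboolP. Qed.

Lemma env_eq_refl : reflexive env_eq.
Proof. by move=> u; apply/env_eqP; rewrite subrr; apply: env_ideal0. Qed.

Lemma env_eq_sym : symmetric env_eq.
Proof.
by move=> u v; apply/env_eqP/env_eqP => /env_idealN; rewrite opprB.
Qed.

Lemma env_eq_trans : transitive env_eq.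
Proof.
move=> v u w /env_eqP uv /env_eqP vw; apply/env_eqP.
by have := env_idealD uv vw; rewrite addrA subrK.
Qed.

Canonical env_equiv := EquivRel env_eq env_eq_refl env_eq_sym env_eq_trans.

Definition enveloping : Type := {eq_quot env_equiv}.

HB.instance Definition _ := Choice.on enveloping.
HB.instance Definition _ := EqQuotient.on enveloping.

Local Notation U := enveloping.

Lemma env_piP (u v : F) : \pi_U u = \pi_U v <-> env_ideal (u - v).
Proof.
by apply: (iff_trans (rwP (eqmodP env_equiv u v)) _); split=> /env_eqP.
Qed.

Definition env_add : U -> U -> U := lift_op2 U +%R.
Definition env_opp : U -> U := lift_op1 U -%R.
Definition env_mul : U -> U -> U := lift_op2 U *%R.
Definition env_scale (k : K) : U -> U := lift_op1 U ( *:%R k).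

Fact env_reprB (u : F) : env_ideal (repr (\pi_U u) - u).
Proof. by apply/env_piP; rewrite reprK. Qed.

Fact env_pi_add : {morph \pi_U : u v / u + v >-> env_add u v}.
Proof.
move=> u v; unlock env_add; apply/esym/env_piP.
by rewrite opprD addrACA; apply: env_idealD; apply: env_reprB.
Qed.

Fact env_pi_opp : {morph \pi_U : u / - u >-> env_opp u}.
Proof.
by move=> u; unlock env_opp; apply/esym/env_piP; rewrite -opprD;
  apply/env_idealN/env_reprB.
Qed.

Fact env_pi_mul : {morph \pi_U : u v / u * v >-> env_mul u v}.
Proof.
move=> u v; unlock env_mul; apply/esym/env_piP.
set u' := repr _; set v' := repr _.
have -> : u' * v' - u * v = (u' - u) * v' + u * (v' - v).
  by rewrite mulrBl mulrBr addrA subrK.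
by apply: env_idealD; [apply: env_idealMr|apply: env_idealMl];
  apply: env_reprB.
Qed.

Fact env_pi_scale k : {morph \pi_U : u / k *: u >-> env_scale k u}.
Proof.
move=> u; unlock env_scale; apply/esym/env_piP.
by rewrite -scalerBr; apply/env_idealZ/env_reprB.
Qed.

Fact env_addA : associative env_add.
Proof. by do 3![elim/quotW=> ?]; rewrite -!env_pi_add addrA. Qed.
Fact env_addC : commutative env_add.
Proof. by do 2![elim/quotW=> ?]; rewrite -!env_pi_add addrC. Qed.
Fact env_add0 : left_id (\pi_U 0) env_add.
Proof. by elim/quotW=> ?; rewrite -env_pi_add add0r. Qed.
Fact env_addN : left_inverse (\pi_U 0) env_opp env_add.
Proof. by elim/quotW=> ?; rewrite -env_pi_opp -env_pi_add addNr. Qed.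

HB.instance Definition _ :=
  GRing.isZmodule.Build U env_addA env_addC env_add0 env_addN.

Fact env_mulA : associative env_mul.
Proof. by do 3![elim/quotW=> ?]; rewrite -!env_pi_mul mulrA. Qed.
Fact env_mul1 : left_id (\pi_U 1) env_mul.
Proof. by elim/quotW=> ?; rewrite -env_pi_mul mul1r. Qed.
Fact env_mulr1 : right_id (\pi_U 1) env_mul.
Proof. by elim/quotW=> ?; rewrite -env_pi_mul mulr1. Qed.
Fact env_mulDl : left_distributive env_mul env_add.
Proof. by do 3![elim/quotW=> ?]; rewrite -!(env_pi_add, env_pi_mul) mulrDl. Qed.
Fact env_mulDr : right_distributive env_mul env_add.
Proof. by do 3![elim/quotW=> ?]; rewrite -!(env_pi_add, env_pi_mul) mulrDr. Qed.
Fact env_one_neq0 : \pi_U 1 != 0 :> U.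
Proof.
apply/eqP => /env_piP/env_ideal_proper; rewrite subr0 mcoeff1 eqxx.
by move/eqP; rewrite oner_eq0.
Qed.

HB.instance Definition _ :=
  GRing.Zmodule_isNzRing.Build U env_mulA env_mul1 env_mulr1 env_mulDl env_mulDr
    env_one_neq0.

Fact env_scaleA a b u : env_scale a (env_scale b u) = env_scale (a * b) u.
Proof. by elim/quotW: u => u; rewrite -!env_pi_scale scalerA. Qed.
Fact env_scale1 : left_id 1 env_scale.
Proof. by elim/quotW=> u; rewrite -env_pi_scale scale1r. Qed.
Fact env_scaleDr : right_distributive env_scale env_add.
Proof.
move=> k; do 2![elim/quotW=> ?].
by rewrite -!(env_pi_add, env_pi_scale) scalerDr.
Qed.
Fact env_scaleDl u : {morph env_scale^~ u : a b / a + b >-> env_add a b}.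
Proof.
by elim/quotW: u => u a b; rewrite -!env_pi_scale -env_pi_add scalerDl.
Qed.

HB.instance Definition _ :=
  GRing.Zmodule_isLmodule.Build K U env_scaleA env_scale1 env_scaleDr
    env_scaleDl.

Fact env_scaleAl k (u v : U) : k *: (u * v) = (k *: u) * v.
Proof.
elim/quotW: u => u; elim/quotW: v => v.
by change (env_scale k (env_mul (\pi u) (\pi v)) =
           env_mul (env_scale k (\pi u)) (\pi v));
  rewrite -!(env_pi_mul, env_pi_scale) scalerAl.
Qed.

HB.instance Definition _ := GRing.Lmodule_isLalgebra.Build K U env_scaleAl.

Fact env_scaleAr k (u v : U) : k *: (u * v) = u * (k *: v).
Proof.
elim/quotW: u => u; elim/quotW: v => v.
by change (env_scale k (env_mul (\pi u) (\pi v)) =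
           env_mul (\pi u) (env_scale k (\pi v)));
  rewrite -!(env_pi_mul, env_pi_scale) free_scaleAr.
Qed.

HB.instance Definition _ := GRing.Lalgebra_isAlgebra.Build K U env_scaleAr.

Lemma env_piD : {morph \pi_U : u v / u + v}. Proof. exact: env_pi_add. Qed.
Lemma env_piN : {morph \pi_U : u / - u}. Proof. exact: env_pi_opp. Qed.
Lemma env_piM : {morph \pi_U : u v / u * v}. Proof. exact: env_pi_mul. Qed.
Lemma env_piZ k : {morph \pi_U : u / k *: u}. Proof. exact: env_pi_scale. Qed.
Lemma env_pi0 : \pi_U 0 = 0. Proof. by []. Qed.
Lemma env_pi1 : \pi_U 1 = 1. Proof. by []. Qed.

Definition env_in (x : g) : enveloping := \pi_U (free_gen x).

Lemma env_in_linear : linear env_in.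
Proof.
move=> k x y; rewrite /env_in -env_piZ -env_piD; apply/env_piP.
exact: env_ideal_linear.
Qed.

Lemma env_in_lie x y :
  env_in (lie x y) = env_in x * env_in y - env_in y * env_in x.
Proof.
rewrite /env_in -!env_piM -env_piN -env_piD; apply/esym/env_piP.
exact: env_ideal_lie.
Qed.

Lemma free_word (m : {fmonom g}) : << m >> = \prod_(x <- m) free_gen x.
Proof.
case: m => m; elim: m => [|x m IH] /=.
  by rewrite big_nil -fmoneE.
rewrite big_cons -IH malgM_def fgmulUU mulr1; congr (<< _ >>).
by apply: val_inj; rewrite /= fmM fmU.
Qed.

Section Universal.
Variables (A : algType K) (f : g -> A).

Definition word_eval (m : {fmonom g}) : A := \prod_(x <- m) f x.

Fact word_eval_mmorphism : mmorphism word_eval.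
Proof.
by split=> [m n|]; rewrite /word_eval ?fm1 ?big_nil // fmM big_cat.
Qed.

HB.instance Definition _ :=
  isMultiplicative.Build {fmonom g} A word_eval word_eval_mmorphism.

Definition free_eval : F -> A := mmap (in_alg A) word_eval.

Lemma free_evalZ k : {morph free_eval : u / k *: u}.
Proof. by move=> u; rewrite /free_eval mmapZ mulr_algl. Qed.

Lemma free_eval0 : free_eval 0 = 0.
Proof. exact: mmap0. Qed.

Lemma free_evalD : {morph free_eval : u v / u + v}.
Proof. exact: mmapD. Qed.

Lemma free_evalB : {morph free_eval : u v / u - v}.
Proof. exact: mmapB. Qed.

Lemma free_evalM : {morph free_eval : u v / u * v}.
Proof.
apply: (commr_mmap_is_multiplicative _).1 => u m m'.
by rewrite /GRing.comm /= mulr_algl mulr_algr.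
Qed.

Lemma free_eval1 : free_eval 1 = 1.
Proof. exact: mmap1. Qed.

Lemma free_eval_gen x : free_eval (free_gen x) = f x.
Proof.
by rewrite /free_eval mmapU /= scale1r mul1r /word_eval fmU big_seq1.
Qed.

Hypothesis f_linear : linear f.
Hypothesis f_lie : forall x y, f (lie x y) = f x * f y - f y * f x.

Lemma free_eval_ideal u : env_ideal u -> free_eval u = 0.
Proof.
elim=> [k x y|x y||{}u v _ u0 _ v0|{}u v _ v0|{}u v _ u0].
- by rewrite free_evalB free_evalD free_evalZ !free_eval_gen f_linear subrr.
- by rewrite !(free_evalB, free_evalM) !free_eval_gen f_lie subrr.
- by rewrite free_eval0.
- by rewrite free_evalD u0 v0 addr0.
- by rewrite free_evalM v0 mulr0.
- by rewrite free_evalM u0 mul0r.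
Qed.

Lemma env_universal : exists! h : enveloping -> A,
  [/\ linear h, monoid_morphism h & forall x, h (env_in x) = f x].
Proof.
pose h (u : enveloping) := free_eval (repr u).
have hpi u : h (\pi_U u) = free_eval u.
  apply/eqP; rewrite -subr_eq0 -free_evalB; apply/eqP/free_eval_ideal.
  exact: env_reprB.
exists h; split; first split.
- move=> k; do 2![elim/quotW=> ?].
  by rewrite -env_piZ -env_piD !hpi free_evalD free_evalZ.
- split; first by rewrite -env_pi1 hpi free_eval1.
  by do 2![elim/quotW=> ?]; rewrite -env_piM !hpi free_evalM.
- by move=> x; rewrite hpi free_eval_gen.
move=> h' [h'lin [h'1 h'M] h'f]; apply/funext; elim/quotW => u.
have h'0 : h' 0 = 0.
  by have := h'lin (-1) 0 0; rewrite scaler0 addr0 scaleN1r addNr.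
have h'D : {morph h' : a b / a + b}.
  by move=> a b; have := h'lin 1 a b; rewrite !scale1r.
have h'Z k : {morph h' : a / k *: a}.
  by move=> a; have := h'lin k a 0; rewrite h'0 !addr0.
rewrite hpi (monalgE u).
rewrite (big_morph _ free_evalD free_eval0).
rewrite (big_morph _ env_piD env_pi0) (big_morph _ h'D h'0).
apply: eq_bigr => m _.
have -> : << u@_m *g m >> = u@_m *: << m >> :> F.
  by apply/malgP => n; rewrite mcoeffZ !mcoeffU mulr_natr.
rewrite free_evalZ env_piZ h'Z; congr (_ *: _); rewrite free_word.
rewrite (big_morph _ free_evalM free_eval1) (big_morph _ env_piM env_pi1).
rewrite (big_morph _ h'M h'1); apply: eq_bigr => x _.
by rewrite free_eval_gen -[RHS]/(h' (env_in x)) h'f.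
Qed.

End Universal.

End Enveloping.

Definition strongly_rigid (K : fieldType) (g : lieAlgType K) : Prop :=
  rigid (enveloping g).

(* Main.v *)
Require Import Defs.
From HB Require Import structures.
From mathcomp Require Import all_boot all_algebra.
From mathcomp Require Import finmap monalg.

(* A scalar 2-cocycle w defines a central extension of g by a line spanned by
   c.  By the Poincare-Birkhoff-Witt theorem, with c the first element of an
   ordered basis, c is not a zero divisor in the enveloping algebra of the
   extension, and reduction modulo c is U(g).  Expanding products of lifted
   elements in powers of c therefore gives a formal deformation of U(g), in
   which [x, y] becomes [x, y] + t w(x, y).  If it is trivial, the order-one
   term of the trivialization yields a derivation f, along the reduction map,
   from the enveloping algebra of the extension to U(g), with f(c) = 1.  The
   augmentation of U(g) composed with f vanishes on commutators of elements of
   the extension, and this writes w as a coboundary. *)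

Set Implicit Arguments.
Unset Strict Implicit.
Unset Printing Implicit Defensive.

Import GRing.Theory.
Local Open Scope ring_scope.
Local Open Scope quotient_scope.

(** * Linear extension of maps from a basis of words *)

Section LinearExtension.
Variables (K : fieldType) (T : choiceType) (V : lmodType K).

Definition malg_lin (f : T -> V) (m : {malg K[T]}) : V :=
  \sum_(s <- msupp m) m@_s *: f s.

Lemma malg_linEw f m (D : {fset T}) : (msupp m `<=` D)%fset ->
  malg_lin f m = \sum_(s <- D) m@_s *: f s.
Proof.
move=> sD; rewrite /malg_lin (big_fset_incl _ sD) // => s _ /mcoeff_outdom ->.
by rewrite scale0r.
Qed.

Fact malg_lin_is_linear f : linear (malg_lin f).
Proof.
move=> k u v; pose D := (msupp u `|` msupp v)%fset.
have uD : (msupp u `<=` D)%fset by apply: fsubsetUl.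
have vD : (msupp v `<=` D)%fset by apply: fsubsetUr.
have kD : (msupp (k *: u + v) `<=` D)%fset.
  by apply: (fsubset_trans (msuppD_le _ _)); apply: fsetSU; apply: msuppZ_le.
rewrite !(malg_linEw f uD, malg_linEw f vD, malg_linEw f kD) scaler_sumr.
rewrite -big_split; apply: eq_bigr => s _ /=.
by rewrite mcoeffD mcoeffZ scalerDl scalerA.
Qed.

HB.instance Definition _ f :=
  GRing.isLinear.Build K {malg K[T]} V *:%R (malg_lin f)
    (malg_lin_is_linear f).

Lemma malg_linU f s : malg_lin f << s >> = f s.
Proof. by rewrite (malg_linEw f msuppU_le) big_seq_fset1 mcoeffUU scale1r. Qed.

Lemma malg_sumE (m : {malg K[T]}) : m = \sum_(s <- msupp m) m@_s *: << s >>.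
Proof.
rewrite [LHS]monalgE; apply: eq_bigr => s _; apply/malgP => t.
by rewrite mcoeffZ !mcoeffU mulr_natr.
Qed.

Lemma malg_ind (P : {malg K[T]} -> Prop) : P 0 ->
  (forall k s m, P m -> P (k *: << s >> + m)) -> forall m, P m.
Proof.
move=> P0 PD m; rewrite [m]malg_sumE.
by elim/big_rec: _ => // s u _; apply: PD.
Qed.

End LinearExtension.

(* Working over an abstract free module keeps unification from unfolding the
   operations of [{malg K[T]}]. *)
Record free_lmod (K : fieldType) (T : Type) := FreeLmod {
  free_mod :> lmodType K;
  free_elt : T -> free_mod;
  free_lin : forall V : lmodType K, (T -> V) -> {linear free_mod -> V};
  free_linE : forall (V : lmodType K) (f : T -> V) s,
    free_lin f (free_elt s) = f s;
  free_ind : forall P : free_mod -> Prop, P 0 ->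
    (forall k s m, P m -> P (k *: free_elt s + m)) -> forall m, P m
}.

Definition malg_free_lmod (K : fieldType) (T : choiceType) : free_lmod K T :=
  @FreeLmod K T {malg K[T]} (fun s => << s >>) (fun V f => malg_lin f)
    (@malg_linU K T) (@malg_ind K T).

(** * Generators and induction for the free and enveloping algebras *)

Section EnvelopingTheory.
Variables (K : fieldType) (g : lieAlgType K).
Local Notation F := {malg K[{fmonom g}]}.
Local Notation U := (enveloping g).

Lemma free_mulUU (w w' : {fmonom g}) :
  << w >> * << w' >> = << mmul w w' >> :> F.
Proof. by rewrite malgM_def fgmulUU mulr1. Qed.

Lemma env_inD x y : env_in (x + y) = env_in x + env_in y :> U.
Proof. by have := env_in_linear 1 x y; rewrite !scale1r. Qed.

Lemma env_in0 : env_in 0 = 0 :> U.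
Proof.
by have := @env_in_linear _ g (-1) 0 0; rewrite scaler0 addr0 scaleN1r addNr.
Qed.

Lemma env_inZ k x : env_in (k *: x) = k *: env_in x :> U.
Proof. by have := env_in_linear k x 0; rewrite env_in0 !addr0. Qed.

Lemma free_alg_ind (P : F -> Prop) :
    P 0 -> (forall u v, P u -> P v -> P (u + v)) ->
    (forall k u, P u -> P (k *: u)) -> P 1 ->
    (forall x u, P u -> P (free_gen x * u)) ->
  forall u, P u.
Proof.
move=> P0 PD PZ P1 PM; apply: malg_ind => // k m u Pu.
apply: (PD _ _ _ Pu); apply: PZ; rewrite free_word.
by elim/big_rec: _ => // x v _; apply: PM.
Qed.

Lemma enveloping_ind (P : enveloping g -> Prop) :
    P 0 -> (forall u v, P u -> P v -> P (u + v)) ->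
    (forall k u, P u -> P (k *: u)) -> P 1 ->
    (forall x u, P u -> P (env_in x * u)) ->
  forall u, P u.
Proof.
move=> P0 PD PZ P1 PM; elim/quotW; apply: free_alg_ind.
- by rewrite env_pi0.
- by move=> u v Pu Pv; rewrite env_piD; apply: PD.
- by move=> k u Pu; rewrite env_piZ; apply: PZ.
- by rewrite env_pi1.
- by move=> x u Pu; rewrite env_piM; apply: PM.
Qed.

End EnvelopingTheory.

(** * The Poincare-Birkhoff-Witt module *)

Section PBW.
Variables (K : fieldType) (h : lieAlgType K) (n : nat).
Variables (b : 'I_n -> h) (co : 'I_n -> h -> K).
Hypothesis co_linear : forall i, scalar (co i).
Hypothesis co_basis : forall i j, co i (b j) = (i == j)%:R.
Hypothesis basis_co : forall x, x = \sum_i co i x *: b i.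

Variable M : free_lmod K (seq 'I_n).

Local Notation wd := (free_elt M).
Local Notation lin := (@free_lin _ _ M _).

Definition ord_le : rel 'I_n := fun i j => (i <= j)%N.

Lemma ord_le_trans : transitive ord_le.
Proof. by move=> j i k; apply: leq_trans. Qed.

(* [pbw_word d i s] is the normal form of [b i] times the ordered word [s];
   [d] is fuel, and [size s] is enough of it. *)
Fixpoint pbw_word (d : nat) (i : 'I_n) (s : seq 'I_n) : M :=
  match d, s with
  | d'.+1, k :: s' =>
      if ord_le i k then wd (i :: s)
      else lin (pbw_word d' k) (pbw_word d' i s')
           + \sum_l co l (lie (b i) (b k)) *: pbw_word d' l s'
  | _, _ => wd (i :: s)
  end.

Lemma pbw_word0 i s : pbw_word 0 i s = wd (i :: s).
Proof. by []. Qed.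

Lemma pbw_word_nil d i : pbw_word d i [::] = wd [:: i].
Proof. by case: d. Qed.

Lemma pbw_word_cons d i k s : pbw_word d.+1 i (k :: s) =
  if ord_le i k then wd [:: i, k & s]
  else lin (pbw_word d k) (pbw_word d i s)
       + \sum_l co l (lie (b i) (b k)) *: pbw_word d l s.
Proof. by []. Qed.

Arguments pbw_word : simpl never.

(** The module is free on all words, so no proof of orderedness is carried along; the bracket
    relation is established only on the span of the ordered words. *)
Definition pbw_act (x : h) : M -> M :=
  lin (fun s => \sum_i co i x *: pbw_word (size s) i s).

HB.instance Definition _ x := GRing.Linear.on (pbw_act x).

Lemma pbw_act_linear m : linear (pbw_act ^~ m).
Proof.
move=> k x y; move: m; apply: free_ind => [|l s m IHm].
  by rewrite !linear0 addr0.
rewrite !(linearP (pbw_act _)) /= IHm scalerDr addrACA; congr (_ + _).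
rewrite /pbw_act !free_linE.
under eq_bigr do rewrite co_linear scalerDl -scalerA.
by rewrite big_split /= -scaler_sumr scalerDr !scalerA [l * k]mulrC.
Qed.

Lemma pbw_actD x y m : pbw_act (x + y) m = pbw_act x m + pbw_act y m.
Proof. by have := pbw_act_linear m 1 x y; rewrite !scale1r. Qed.

Lemma pbw_act0 m : pbw_act 0 m = 0.
Proof.
by have := pbw_act_linear m (-1) 0 0; rewrite scaler0 addr0 scaleN1r addNr.
Qed.

Lemma pbw_actZ k x m : pbw_act (k *: x) m = k *: pbw_act x m.
Proof. by have := pbw_act_linear m k x 0; rewrite pbw_act0 !addr0. Qed.

Lemma pbw_actN x m : pbw_act (- x) m = - pbw_act x m.
Proof. by rewrite -[- x]scaleN1r pbw_actZ scaleN1r. Qed.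

Lemma pbw_act_word x s :
  pbw_act x (wd s) = \sum_i co i x *: pbw_word (size s) i s.
Proof. exact: free_linE. Qed.

Lemma pbw_act_basis i s : pbw_act (b i) (wd s) = pbw_word (size s) i s.
Proof.
rewrite pbw_act_word (bigD1 i) //= big1 ?addr0 => [|j ji].
  by rewrite co_basis eqxx scale1r.
by rewrite co_basis (negPf ji) scale0r.
Qed.

Lemma pbw_word_le d i s : path ord_le i s -> pbw_word d i s = wd (i :: s).
Proof.
case: s => [|k s] ks; first by rewrite pbw_word_nil.
case: d => [|d]; first by rewrite pbw_word0.
by rewrite pbw_word_cons; case/andP: ks => ->.
Qed.

(** * Length filtration on ordered words and leading terms *)

Inductive pbw_span (d : nat) : M -> Prop :=
| pbw_span0 : pbw_span d 0
| pbw_spanP k s m : sorted ord_le s -> (size s <= d)%N ->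
    pbw_span d m -> pbw_span d (k *: wd s + m).

Lemma pbw_spanD d u v : pbw_span d u -> pbw_span d v -> pbw_span d (u + v).
Proof.
move=> du dv; elim: du => [|k s m ss sd _ IHm]; first by rewrite add0r.
by rewrite -addrA; apply: pbw_spanP.
Qed.

Lemma pbw_spanZ d k u : pbw_span d u -> pbw_span d (k *: u).
Proof.
elim=> [|l s m ss sd _ IHm]; first by rewrite scaler0; apply: pbw_span0.
by rewrite scalerDr scalerA; apply: pbw_spanP.
Qed.

Lemma pbw_span_sum d (I : Type) (r : seq I) (F : I -> M) :
  (forall i, pbw_span d (F i)) -> pbw_span d (\sum_(i <- r) F i).
Proof.
move=> dF; apply: (big_ind (pbw_span d)) => //; first exact: pbw_span0.
by move=> u v; apply: pbw_spanD.
Qed.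

Lemma pbw_spanU d s : sorted ord_le s -> (size s <= d)%N -> pbw_span d (wd s).
Proof.
move=> ss sd; rewrite -[wd s]addr0 -[wd s]scale1r.
by apply: pbw_spanP => //; apply: pbw_span0.
Qed.

Lemma pbw_spanW d e m : (d <= e)%N -> pbw_span d m -> pbw_span e m.
Proof.
move=> de; elim=> [|k s {}m ss sd _ IHm]; first exact: pbw_span0.
by apply: pbw_spanP => //; apply: leq_trans de.
Qed.

Lemma pbw_span_linear (f : {linear M -> M}) d e m :
  (forall s, sorted ord_le s -> (size s <= d)%N -> pbw_span e (f (wd s))) ->
  pbw_span d m -> pbw_span e (f m).
Proof.
move=> fe; elim=> [|k s {}m ss sd _ IHm].
  by rewrite linear0; apply: pbw_span0.
by rewrite linearP; apply: pbw_spanD => //; apply/pbw_spanZ/fe.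
Qed.

Lemma pbw_span_ext (V : lmodType K) (f1 f2 : {linear M -> V}) d m :
  (forall s, sorted ord_le s -> (size s <= d)%N -> f1 (wd s) = f2 (wd s)) ->
  pbw_span d m -> f1 m = f2 m.
Proof.
move=> eqf; elim=> [|k s {}m ss sd _ IHm]; first by rewrite !linear0.
by rewrite !linearP IHm eqf.
Qed.

Definition pbw_lead i s (m : M) :=
  exists t r, [/\ sorted ord_le t, perm_eq t (i :: s),
                  pbw_span (size s) r & m = wd t + r].

Lemma pbw_lead_span i s m : pbw_lead i s m -> pbw_span (size s).+1 m.
Proof.
case=> t [r [ts ti dr ->]]; apply: pbw_spanD; last exact: pbw_spanW dr.
by apply: pbw_spanU => //; rewrite (perm_size ti).
Qed.

Lemma path_perm_le k i s t : ord_le k i -> path ord_le k s ->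
  sorted ord_le t -> perm_eq t (i :: s) -> path ord_le k t.
Proof.
rewrite !(path_sortedE ord_le_trans) => ki /andP[ks _] -> /perm_all ->.
by rewrite /= ki ks.
Qed.

Lemma ord_leN i k : ~~ ord_le i k -> ord_le k i.
Proof. by rewrite /ord_le -ltnNge => /ltnW. Qed.

(** Both claims need a simultaneous induction: the outer recursive call is applied to a normal form,
    and only its leading-term decomposition shows that the fuel suffices there. *)
Lemma pbw_word_fuel d i s : sorted ord_le s -> (size s <= d)%N ->
  pbw_word d.+1 i s = pbw_word d i s /\ pbw_lead i s (pbw_word d i s).
Proof.
have lead_nil j : pbw_lead j [::] (wd [:: j]).
  by exists [:: j], 0; rewrite addr0; split=> //; apply: pbw_span0.
elim: d i s => [|d IHd] i s ss sd.
  have -> : s = [::] by apply: size0nil; apply/eqP; rewrite -leqn0.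
  by rewrite !pbw_word_nil.
case: s ss sd => [|k s] ss sd; first by rewrite !pbw_word_nil.
have [ik|Nik] := boolP (ord_le i k).
  rewrite !pbw_word_le /= ?ik //; split=> //.
  exists [:: i, k & s], 0; rewrite addr0.
  by split=> //=; [rewrite ik|apply: pbw_span0].
have ki := ord_leN Nik.
have ss' : sorted ord_le s by apply: path_sorted ss.
have sd' : (size s <= d)%N by [].
have fuel j u : sorted ord_le u -> (size u <= size s)%N ->
    pbw_word d.+1 j u = pbw_word d j u.
  by move=> us ud; apply: (proj1 (IHd j u us (leq_trans ud sd'))).
have [eqi [t [r [ts ti dt wE]]]] := IHd i s ss' sd'.
(* The leading word [t] may be longer than the fuel [d], but [k] precedes it, so prepending [k]
   needs no recursion. The remainder [r] is short enough for the fuel. *)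
have kt := path_perm_le ki ss ts ti.
rewrite !pbw_word_cons (negPf Nik).
split.
  rewrite eqi wE !linearD /= !free_linE !(pbw_word_le _ kt).
  have -> : lin (pbw_word d.+1 k) r = lin (pbw_word d k) r.
    by apply: pbw_span_ext dt => u us ud; rewrite /= !free_linE fuel.
  by under eq_bigr do rewrite fuel //.
rewrite wE linearD /= free_linE (pbw_word_le _ kt) -addrA.
exists (k :: t); eexists; split; last by reflexivity.
- exact: kt.
- by apply/permP => a; rewrite /= (permP ti) /= addnCA.
have lead j u : sorted ord_le u -> (size u <= size s)%N ->
    pbw_span (size s).+1 (pbw_word d j u).
  move=> us ud; have [_ /pbw_lead_span] := IHd j u us (leq_trans ud sd').
  exact: pbw_spanW.
apply: pbw_spanD; last by apply: pbw_span_sum => l; apply/pbw_spanZ/lead.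
by apply: pbw_span_linear dt => u us ud; rewrite /= free_linE; apply: lead.
Qed.

Lemma pbw_act_fuel d i s : sorted ord_le s -> (size s <= d)%N ->
  pbw_act (b i) (wd s) = pbw_word d i s.
Proof.
move=> ss; rewrite pbw_act_basis; elim: d => [|d IHd].
  by rewrite leqn0 => /eqP/size0nil->.
rewrite leq_eqVlt => /predU1P[<- //|sd].
by rewrite IHd // (proj1 (pbw_word_fuel i ss sd)).
Qed.

Lemma pbw_act_lead i s :
  sorted ord_le s -> pbw_lead i s (pbw_act (b i) (wd s)).
Proof.
by move=> ss; rewrite pbw_act_basis; case: (pbw_word_fuel i ss (leqnn _)).
Qed.

Lemma pbw_act_le i s : path ord_le i s -> pbw_act (b i) (wd s) = wd (i :: s).
Proof. by move=> si; rewrite pbw_act_basis pbw_word_le. Qed.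

(** This is the recursive clause of [pbw_word] freed of fuel: the leading word of [b i] times [s]
    needs none, and the remainder has length at most [size s]. *)
Lemma pbw_act_gt i k s : path ord_le k s -> ~~ ord_le i k ->
  pbw_act (b i) (wd (k :: s)) =
  pbw_act (b k) (pbw_act (b i) (wd s)) + pbw_act (lie (b i) (b k)) (wd s).
Proof.
move=> ks Nik; have ss := path_sorted ks.
have [t [r [ts ti dt wE]]] := pbw_act_lead i ss.
have kt := path_perm_le (ord_leN Nik) ks ts ti.
rewrite [LHS]pbw_act_basis pbw_word_cons (negPf Nik).
rewrite -pbw_act_basis -pbw_act_word.
rewrite wE !linearD /= free_linE (pbw_word_le _ kt) (pbw_act_le kt).
have -> // : lin (pbw_word (size s) k) r = pbw_act (b k) r.
by apply: pbw_span_ext dt => u us ud; rewrite /= free_linE -pbw_act_fuel.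
Qed.

Lemma pbw_act_span d x m : pbw_span d m -> pbw_span d.+1 (pbw_act x m).
Proof.
apply: pbw_span_linear => s ss sd; rewrite /= pbw_act_word.
apply: pbw_span_sum => i; apply/pbw_spanZ/(@pbw_spanW (size s).+1) => //.
by rewrite -pbw_act_basis; apply/pbw_lead_span/pbw_act_lead.
Qed.

(** * The bracket relation on the span of ordered words *)

Definition pbw_rel x y (m : M) : Prop :=
  pbw_act x (pbw_act y m) = pbw_act y (pbw_act x m) + pbw_act (lie x y) m.

Lemma pbw_rel_sym x y m : pbw_rel x y m -> pbw_rel y x m.
Proof.
by rewrite /pbw_rel => ->; rewrite [lie x y]lieC pbw_actN addrNK.
Qed.

Lemma basis_ind (P : h -> Prop) : P 0 ->
  (forall k i y, P y -> P (k *: b i + y)) -> forall x, P x.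
Proof.
move=> P0 PD x; rewrite [x]basis_co.
elim/big_rec: _ => // i y _; exact: PD.
Qed.

Lemma pbw_rel_basis m : (forall i j, pbw_rel (b i) (b j) m) ->
  forall x y, pbw_rel x y m.
Proof.
have relD k x x' y : pbw_rel x y m -> pbw_rel x' y m ->
    pbw_rel (k *: x + x') y m.
  rewrite /pbw_rel lie_linearl !pbw_actD !pbw_actZ !linearD !linearZ /=.
  move=> -> ->; by rewrite scalerDr addrACA.
have rel0 y : pbw_rel 0 y m.
  have lie0 : lie 0 y = 0.
    by have := lie_linearl y (-1) 0 0; rewrite scaler0 addr0 scaleN1r addNr.
  by rewrite /pbw_rel lie0 !pbw_act0 linear0 addr0.
move=> relb x y; 
apply: (basis_ind (P := fun x => pbw_rel x y m)) => [|k i x' relx'].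
  exact: rel0.
refine (relD k _ _ _ _ relx'); apply: pbw_rel_sym.
apply: (basis_ind (P := fun y => pbw_rel y (b i) m)) => [|l j y' rely'].
  exact: rel0.
exact: relD (relb _ _) rely'.
Qed.

Lemma pbw_rel_span x y d m :
  (forall s, sorted ord_le s -> (size s <= d)%N -> pbw_rel x y (wd s)) ->
  pbw_span d m -> pbw_rel x y m.
Proof.
move=> rel dm.
pose f1 := pbw_act x \o pbw_act y.
pose f2 := (pbw_act y \o pbw_act x) \+ pbw_act (lie x y).
exact: (@pbw_span_ext _ f1 f2 d).
Qed.

(** For [i] above [k] this is the recursive clause. For [i] below [k], transitivity puts [i] below
    [s] as well and the roles are exchanged; for [i = k] the bracket vanishes. *)
Lemma pbw_rel_le i k s : path ord_le k s -> pbw_rel (b i) (b k) (wd s).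
Proof.
wlog ik : i k / ~~ ord_le i k => [th|] ks.
  have [ik|/th] := boolP (ord_le i k); last exact.
  have [ki|Nki] := boolP (ord_le k i).
    have -> : i = k by apply/val_inj/anti_leq/andP.
    by rewrite /pbw_rel lie_alt pbw_act0 addr0.
  apply/pbw_rel_sym/th => //.
  move: ks; rewrite !(path_sortedE ord_le_trans) => /andP[/allP ks ->].
  by rewrite andbT; apply/allP => j /ks; apply: ord_le_trans.
by rewrite /pbw_rel (pbw_act_le ks) pbw_act_gt.
Qed.

(* When neither of the two indices is below the word, its first letter [k] is
   moved to the front; the leading term of the result is a word that [k]
   precedes, and the rest is shorter. *)
Lemma pbw_rel_word s x y : sorted ord_le s -> pbw_rel x y (wd s).
Proof.
move: {2}(size s) (leqnn (size s)) => d; elim: d s x y => [|d IHd] s x y sd ss.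
  apply: pbw_rel_basis => i j; apply: pbw_rel_le.
  by case: s sd {ss}.
move: x y; apply: pbw_rel_basis => i j.
case: s sd ss => [_ _|k s sd ks]; first exact: pbw_rel_le.
have ss := path_sorted ks.
have [ik|Nik] := boolP (ord_le i k).
  by apply/pbw_rel_sym/pbw_rel_le; rewrite /= ik.
have [jk|Njk] := boolP (ord_le j k); first by apply/pbw_rel_le; rewrite /= jk.
have IHs x y : pbw_rel x y (wd s) by apply: IHd.
have relk p q : ~~ ord_le p k -> ~~ ord_le q k ->
    pbw_rel (b p) (b k) (pbw_act (b q) (wd s)).
  move=> Npk Nqk; have [t [r [ts ti dt ->]]] := pbw_act_lead q ss.
  have rel1 : pbw_rel (b p) (b k) r.
    apply: pbw_rel_span dt => u us ud.
    by apply: IHd => //; apply: leq_trans ud sd.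
  have rel2 : pbw_rel (b p) (b k) (wd t).
    by apply/pbw_rel_le/(path_perm_le (ord_leN Nqk) ks ts ti).
  by rewrite /pbw_rel !linearD /= rel1 rel2 addrACA.
(* Exchanging [p] and [q] only swaps the two middle terms. The first terms then differ by the
   relation on [s], and the last ones by the Jacobi identity [lieE]. *)
have actE p q : ~~ ord_le p k -> ~~ ord_le q k ->
    pbw_act (b p) (pbw_act (b q) (wd (k :: s))) =
    pbw_act (b k) (pbw_act (b p) (pbw_act (b q) (wd s)))
    + (pbw_act (lie (b p) (b k)) (pbw_act (b q) (wd s))
    + pbw_act (lie (b q) (b k)) (pbw_act (b p) (wd s)))
    + pbw_act (lie (b p) (lie (b q) (b k))) (wd s).
  move=> Npk Nqk; rewrite pbw_act_gt // linearD /= relk //.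
  rewrite [pbw_act (b p) (pbw_act (lie _ _) _)]IHs.
  by rewrite !addrA.
have lieE : lie (b i) (lie (b j) (b k)) =
    lie (b j) (lie (b i) (b k)) + lie (lie (b i) (b j)) (b k).
  apply/eqP; rewrite -subr_eq0 opprD addrA.
  rewrite [lie (lie _ _) _]lieC opprK -(lie_jacobi (b i) (b j) (b k)).
  by rewrite [lie (b k) (b i)]lieC linearN.
rewrite /pbw_rel !actE // [pbw_act (b i) (pbw_act (b j) _)]IHs linearD /=.
rewrite -(pbw_act_le ks) [pbw_act (lie _ _) (pbw_act (b k) _)]IHs.
rewrite lieE pbw_actD.
rewrite [pbw_act (lie (b j) (b k)) _ + _]addrC.
by rewrite [X in X + _ = _]addrAC addrACA.
Qed.

Lemma pbw_relT d m x y : pbw_span d m -> pbw_rel x y m.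
Proof. by apply: pbw_rel_span => s ss _; apply: pbw_rel_word. Qed.

(** * Action of the enveloping algebra and division by the first generator *)

Local Notation F := {malg K[{fmonom h}]}.
Local Notation U := (enveloping h).

Definition pbw_op (u : F) (m : M) : M :=
  malg_lin (fun w : {fmonom h} => foldr pbw_act m w) u.

Lemma pbw_opPl k u v m :
  pbw_op (k *: u + v) m = k *: pbw_op u m + pbw_op v m.
Proof. by rewrite /pbw_op linearP. Qed.

Lemma pbw_op0l m : pbw_op 0 m = 0.
Proof. by rewrite /pbw_op linear0. Qed.

Lemma pbw_opDl u v m : pbw_op (u + v) m = pbw_op u m + pbw_op v m.
Proof. by rewrite /pbw_op linearD. Qed.

Lemma pbw_opBl u v m : pbw_op (u - v) m = pbw_op u m - pbw_op v m.
Proof. by rewrite /pbw_op linearB. Qed.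

Lemma pbw_opZl k u m : pbw_op (k *: u) m = k *: pbw_op u m.
Proof. by rewrite /pbw_op linearZ. Qed.

Lemma pbw_opU w m : pbw_op << w >> m = foldr pbw_act m w.
Proof. exact: malg_linU. Qed.

Lemma pbw_op0r u : pbw_op u 0 = 0.
Proof.
move: u; apply: malg_ind => [|k w u IHu]; first exact: pbw_op0l.
rewrite pbw_opDl pbw_opZl IHu addr0 pbw_opU.
have -> : foldr pbw_act 0 w = 0 by elim: (val w) => //= x v ->; rewrite linear0.
exact: scaler0.
Qed.

Lemma pbw_opDr u m m' : pbw_op u (m + m') = pbw_op u m + pbw_op u m'.
Proof.
move: u; apply: malg_ind => [|k w u IHu]; first by rewrite !pbw_op0l addr0.
rewrite !pbw_opDl !pbw_opZl IHu !pbw_opU addrACA -scalerDr.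
have -> // : foldr pbw_act (m + m') w = foldr pbw_act m w + foldr pbw_act m' w.
by elim: (val w) => //= x v ->; rewrite linearD.
Qed.

Lemma pbw_opZr k u m : pbw_op u (k *: m) = k *: pbw_op u m.
Proof.
move: u; apply: malg_ind => [|l w u IHu]; first by rewrite !pbw_op0l scaler0.
rewrite !pbw_opDl !pbw_opZl IHu !pbw_opU scalerDr !scalerA mulrC -!scalerA.
have -> // : foldr pbw_act (k *: m) w = k *: foldr pbw_act m w.
by elim: (val w) => //= x v ->; rewrite linearZ.
Qed.

Lemma pbw_op_gen x m : pbw_op (free_gen x) m = pbw_act x m.
Proof. by rewrite pbw_opU fmU. Qed.

Lemma pbw_opM u v m : pbw_op (u * v) m = pbw_op u (pbw_op v m).
Proof.
move: u; apply: malg_ind => [|k w u IHu]; first by rewrite mul0r !pbw_op0l.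
rewrite mulrDl -scalerAl [LHS]pbw_opPl [RHS]pbw_opPl.
refine (congr2 +%R (congr1 ( *:%R k) _) IHu).
rewrite pbw_opU; move: v {IHu u k}; apply: malg_ind => [|k w' v IHv].
  by rewrite mulr0 !pbw_op0l -(pbw_opU w) pbw_op0r.
rewrite mulrDr -free_scaleAr [LHS]pbw_opPl [in RHS]pbw_opPl -(pbw_opU w).
rewrite [RHS]pbw_opDr pbw_opZr; refine (congr2 +%R (congr1 ( *:%R k) _) _).
  by rewrite free_mulUU [RHS]pbw_opU (pbw_opU w') [LHS]pbw_opU fmM foldr_cat.
by rewrite pbw_opU.
Qed.

Definition pbw_normal m := exists d, pbw_span d m.

Lemma pbw_normalD m m' : pbw_normal m -> pbw_normal m' -> pbw_normal (m + m').
Proof.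
move=> [d dm] [e em]; exists (maxn d e); apply: pbw_spanD.
  by apply: pbw_spanW dm; apply: leq_maxl.
by apply: pbw_spanW em; apply: leq_maxr.
Qed.

Lemma pbw_op_normal u m : pbw_normal m -> pbw_normal (pbw_op u m).
Proof.
move=> Nm; move: u; apply: malg_ind => [|k w u Nu].
  by rewrite pbw_op0l; exists 0%N; apply: pbw_span0.
rewrite pbw_opDl; apply: pbw_normalD => //; rewrite pbw_opZl pbw_opU.
have [d dw] : pbw_normal (foldr pbw_act m w).
  elim: (val w) => //= x v [d dv]; exists d.+1; exact: pbw_act_span.
by exists d; apply: pbw_spanZ.
Qed.

(** The bracket relation is known only on normal vectors; these are stable under the action, which
    handles right multiples. *)
Lemma pbw_op_ideal u m : env_ideal u -> pbw_normal m -> pbw_op u m = 0.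
Proof.
move=> Iu; elim: Iu m => {u}
  [k x y|x y||u v _ IHu _ IHv|u v _ IHv|u v _ IHu] m Nm.
- rewrite pbw_opBl pbw_opPl 3!pbw_op_gen pbw_act_linear.
  exact: subrr.
- have opB A B C p q r : pbw_op A m = p -> pbw_op B m = q -> pbw_op C m = r ->
      pbw_op (A - B - C) m = p - q - r.
    by move=> <- <- <-; rewrite 2!pbw_opBl.
  have opg p q : pbw_op (free_gen p * free_gen q) m = pbw_act p (pbw_act q m).
    by rewrite pbw_opM 2!pbw_op_gen.
  apply: (etrans (opB _ _ _ _ _ _ (opg x y) (opg y x) (pbw_op_gen _ _))).
  case: Nm => d dm; rewrite (pbw_relT x y dm) -addrA -opprD.
  exact: subrr.
- exact: pbw_op0l.
- by rewrite pbw_opDl IHu // IHv // addr0.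
- by rewrite pbw_opM IHv // pbw_op0r.
- by rewrite pbw_opM IHu //; apply: pbw_op_normal.
Qed.

(** * Normal forms and their evaluation *)

Definition pbw_nf (w : U) : M := pbw_op (repr w) (wd [::]).

Lemma pbw_normal_nil : pbw_normal (wd [::]).
Proof. by exists 0%N; apply: pbw_spanU. Qed.

Lemma pbw_nf_pi (u : F) : pbw_nf (\pi_U u) = pbw_op u (wd [::]).
Proof.
apply/eqP; rewrite -subr_eq0 -pbw_opBl; apply/eqP/pbw_op_ideal.
  exact: env_reprB.
exact: pbw_normal_nil.
Qed.

Lemma pbw_nf_linear : linear pbw_nf.
Proof.
move=> k; do 2![elim/quotW=> ?].
by rewrite -env_piZ -env_piD !pbw_nf_pi pbw_opDl pbw_opZl.
Qed.

Lemma pbw_nfM x w : pbw_nf (env_in x * w) = pbw_act x (pbw_nf w).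
Proof.
by elim/quotW: w => u; rewrite /env_in -env_piM !pbw_nf_pi pbw_opM pbw_op_gen.
Qed.

Definition pbw_eval : {linear M -> U} :=
  lin (fun s => \prod_(i <- s) env_in (b i)).

Lemma env_in_sum x : env_in x = \sum_i co i x *: env_in (b i) :> U.
Proof.
rewrite {1}[x]basis_co (big_morph _ (@env_inD _ h) (@env_in0 _ h)).
by apply: eq_bigr => i _; rewrite env_inZ.
Qed.

(** Each rewriting step is an identity in the enveloping algebra, so neither enough fuel nor an
    ordered word is required. *)
Lemma pbw_eval_word d i s :
  pbw_eval (pbw_word d i s) = env_in (b i) * pbw_eval (wd s).
Proof.
elim: d i s => [|d IHd] i s.
  by rewrite pbw_word0 !free_linE big_cons.
case: s => [|k s]; first by rewrite pbw_word_nil !free_linE big_cons.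
rewrite pbw_word_cons; case: ifP => _; first by rewrite !free_linE big_cons.
have evalE j m : pbw_eval (lin (pbw_word d j) m) = env_in (b j) * pbw_eval m.
  move: m; apply: free_ind => [|l t m IHm]; first by rewrite !linear0 mulr0.
  by rewrite !linearP /= IHm free_linE IHd mulrDr scalerAr.
rewrite linearD linear_sum /= evalE IHd.
under eq_bigr do rewrite linearZ /= IHd scalerAl.
rewrite -mulr_suml -env_in_sum env_in_lie mulrBl -!mulrA.
rewrite addrC subrK [pbw_eval (wd (k :: s))]free_linE big_cons.
by rewrite [pbw_eval (wd s)]free_linE.
Qed.

Lemma pbw_eval_act x m : pbw_eval (pbw_act x m) = env_in x * pbw_eval m.
Proof.
move: m; apply: free_ind => [|k s m IHm]; first by rewrite !linear0 mulr0.
rewrite !linearP /= IHm mulrDr -scalerAr; congr (_ *: _ + _).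
rewrite pbw_act_word linear_sum env_in_sum mulr_suml.
by apply: eq_bigr => i _; rewrite linearZ /= pbw_eval_word scalerAl.
Qed.

Lemma pbw_eval_op u m : pbw_eval (pbw_op u m) = \pi_U u * pbw_eval m.
Proof.
move: u; apply: malg_ind => [|k w u IHu].
  by rewrite pbw_op0l linear0 env_pi0 mul0r.
rewrite pbw_opPl linearP env_piD env_piZ mulrDl IHu -scalerAl.
congr (_ *: _ + _).
rewrite pbw_opU free_word (big_morph _ (@env_piM _ h) (@env_pi1 _ h)).
elim: (val w) => [|x v IHv] /=; first by rewrite big_nil mul1r.
by rewrite pbw_eval_act IHv big_cons mulrA.
Qed.

(** Evaluation intertwines the action with left multiplication and sends the empty word to 1. *)
Lemma pbw_nfK w : pbw_eval (pbw_nf w) = w.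
Proof. by rewrite /pbw_nf pbw_eval_op free_linE big_nil mulr1 reprK. Qed.

Variable i0 : 'I_n.
Hypothesis i0_min : forall j, ord_le i0 j.

Definition pbw_behead : {linear M -> M} :=
  lin (fun s => if s is i :: s' then if i == i0 then wd s' else 0 else 0).

Definition pbw_div (w : U) : U := pbw_eval (pbw_behead (pbw_nf w)).

Lemma pbw_div_linear : linear pbw_div.
Proof. by move=> k u v; rewrite /pbw_div pbw_nf_linear !linearP. Qed.

(** Since [i0] is least, [b i0] acts on every word, ordered or not, by prepending [i0], and
    [pbw_behead] undoes this. Left multiplication by [b i0] is therefore injective. *)
Lemma pbw_divK w : pbw_div (env_in (b i0) * w) = w.
Proof.
rewrite /pbw_div pbw_nfM.
have beheadK m : pbw_behead (pbw_act (b i0) m) = m.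
  move: m; apply: free_ind => [|k s m IHm]; first by rewrite !linear0.
  rewrite !linearP /= IHm pbw_act_basis.
  have -> : pbw_word (size s) i0 s = wd (i0 :: s).
    case: s => [|j s]; first by rewrite pbw_word_nil.
    by rewrite pbw_word_cons i0_min.
  by rewrite free_linE eqxx.
by rewrite beheadK pbw_nfK.
Qed.

End PBW.

(** * Deformations from a central non-zero-divisor *)

(** This is the coefficient of t in the triviality equation for two constant series. *)
Lemma trivial_deformation_order1 (K : fieldType) (A : algType K)
    (mu : nat -> A -> A -> A) :
  formal_deformation mu -> trivial_deformation mu ->
  exists2 phi : A -> A, linear phi &
    forall a b, mu 1%N a b + phi (a * b) = a * phi b + phi a * b.
Proof.
move=> [mul mur mu0 _] [phi [phil phi0 phiM]]; exists (phi 1%N) => // a b.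
have lin0 (f : A -> A) : linear f -> f 0 = 0.
  by move=> fl; have := fl (-1) 0 0; rewrite scaler0 addr0 scaleN1r addNr.
pose cst (x : A) (i : nat) := if i == 0%N then x else 0.
have app0 x : fps_app phi (cst x) 0 = x by rewrite /fps_app big_ord1 phi0.
have app1 x : fps_app phi (cst x) 1 = phi 1%N x.
  rewrite /fps_app big_ord_recl big_ord1 /=.
  by rewrite subn0 /bump /= subnn /cst /= lin0 // add0r.
have mul0 : fps_mul mu (cst a) (cst b) 0 = a * b.
  by rewrite /fps_mul !big_ord1 /= mu0.
have mul1 : fps_mul mu (cst a) (cst b) 1 = mu 1%N a b.
  rewrite /fps_mul big_ord_recl big_ord1 /= big_ord_recl !big_ord1 /=.
  by rewrite /cst /= !mu0 mulr0 mul0r !add0r.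
have := phiM (cst a) (cst b) 1%N.
rewrite /fps_mul0 [in X in _ = X]big_ord_recl big_ord1 /= /bump /= !subn0 subnn.
rewrite !app0 !app1 => <-.
rewrite /fps_app big_ord_recl big_ord1 /= /bump /=.
by rewrite subn0 subnn mul0 mul1 phi0.
Qed.

(** * Expansion in powers of the central element *)

Section FlatDeformation.
Variables (K : fieldType) (A B : algType K).
Variables (p : {linear B -> A}) (D : {linear B -> B}) (s : {linear A -> B}).
Variable c : B.
Hypothesis pM : {morph p : x y / x * y}.
Hypothesis p1 : p 1 = 1.
Hypothesis pc : p c = 0.
Hypothesis cC : forall w, w * c = c * w.
Hypothesis DK : forall w, D (c * w) = w.
Hypothesis sK : forall a, p (s a) = a.
Hypothesis sp : forall w, s (p w) = w - c * D w.

(** Iterating [w = s (p w) + c * D w] expands [w] in powers of [c] with digits in the image of [s];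
    this is the digit of order [r]. *)
Definition flat_coef (r : nat) (w : B) : A := p (iter r D w).
Definition flat_mul (r : nat) (a b : A) : A := flat_coef r (s a * s b).

Lemma flat_coef_linear r : linear (flat_coef r).
Proof.
move=> k u v; rewrite /flat_coef.
suff -> : iter r D (k *: u + v) = k *: iter r D u + iter r D v.
  by rewrite linearP.
by elim: r => //= r ->; rewrite linearP.
Qed.

HB.instance Definition _ r :=
  GRing.isLinear.Build K B A *:%R (flat_coef r) (flat_coef_linear r).

Lemma iter_flat_div n w : iter n D (c ^+ n * w) = w.
Proof. by elim: n => [|n IHn]; rewrite ?mul1r // iterSr exprS -mulrA DK. Qed.

(** Multiplication by [c ^+ i] shifts the digits by [i] places; when [i > n], a factor [c] survives
    the [n] divisions and [p] kills it. *)
Lemma flat_coefX n i w :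
  flat_coef n (c ^+ i * w) = if (i <= n)%N then flat_coef (n - i) w else 0.
Proof.
rewrite /flat_coef; case: leqP => [le_in|lt_ni].
  by rewrite -{1}(subnK le_in) iterD iter_flat_div.
rewrite -(subnKC (ltnW lt_ni)) exprD -mulrA iter_flat_div pM.
by rewrite -(prednK (_ : 0 < i - n)%N) ?subn_gt0 // exprS pM pc !mul0r.
Qed.

Lemma central_exprC w n : w * c ^+ n = c ^+ n * w.
Proof. exact/commrX/cC. Qed.

Definition flat_eval (N : nat) (a : nat -> A) : B :=
  \sum_(i < N) c ^+ i * s (a i).

(** The sum telescopes, each digit being [w - c * D w] for the successive quotients. *)
Lemma flat_eval_coef N w :
  flat_eval N (flat_coef ^~ w) = w - c ^+ N * iter N D w.
Proof.
rewrite /flat_eval; elim: N => [|N IHN].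
  by rewrite big_ord0 mul1r subrr.
by rewrite big_ord_recr IHN /= sp mulrBr addrA subrK mulrA -exprSr.
Qed.

(** The product is a sum of terms [c ^+ (i + j) * (s (a i) * s (b j))]. Each one contributes its
    digit of order [n - (i + j)], and nothing when [i + j > n], so the truncation at [N] is
    harmless. *)
Lemma flat_coef_mul N n a b : (n < N)%N ->
  flat_coef n (flat_eval N a * flat_eval N b) = fps_mul flat_mul a b n.
Proof.
move=> ltnN.
have sum_le (i : nat) (F : nat -> A) : (i <= n)%N ->
    \sum_(j < N | (i + j <= n)%N) F j = \sum_(j < (n - i).+1) F j.
  move=> le_in; have le_N : ((n - i).+1 <= N)%N.
    by apply: leq_trans ltnN; rewrite ltnS leq_subr.
  rewrite (big_ord_widen _ F le_N); apply: eq_bigl => j.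
  by rewrite ltnS leq_subRL.
transitivity (\sum_(i < N) \sum_(j < N | (i + j <= n)%N)
    flat_mul (n - (i + j)) (a i) (b j)).
  rewrite /flat_eval mulr_suml linear_sum; apply: eq_bigr => i _.
  rewrite mulr_sumr linear_sum [RHS]big_mkcond; apply: eq_bigr => j _ /=.
  rewrite mulrA -(mulrA _ (s _)) central_exprC mulrA -exprD.
  by rewrite -mulrA flat_coefX.
rewrite /fps_mul (big_ord_widen _ (fun r =>
  \sum_(i < (n - r).+1) flat_mul r (a i) (b (n - r - i)%N)) ltnN).
transitivity (\sum_(r < N) \sum_(i < N | (r + i <= n)%N)
    flat_mul r (a i) (b (n - r - i)%N)); last first.
  rewrite [RHS]big_mkcond; apply: eq_bigr => r _; rewrite ltnS.
  case: leqP => [le_rn|lt_nr].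
    by rewrite (sum_le r (fun i => flat_mul r (a i) (b (n - r - i)%N))).
  by rewrite big1 // => i; rewrite leqNgt (leq_trans lt_nr) // leq_addr.
rewrite [RHS](exchange_big_dep predT) //=; apply: eq_bigr => i _.
have [le_in|lt_ni] := leqP i n; last first.
  rewrite !big1 // => j; rewrite leqNgt.
    by rewrite (leq_trans lt_ni) // leq_addl.
  by rewrite (leq_trans lt_ni) // leq_addr.
rewrite (sum_le i (fun j => flat_mul (n - (i + j)) (a i) (b j))) //.
under [RHS]eq_bigl do rewrite addnC.
rewrite (sum_le i (fun r => flat_mul r (a i) (b (n - r - i)%N))) //.
(* For fixed [i], reversal trades the index of [b] for the order [r = n - i - j] of the product. *)
rewrite (reindex_inj rev_ord_inj); apply: eq_bigr => j _ /=.
have le_j : (j <= n - i)%N by rewrite -ltnS.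
have le_jn : (j <= n)%N by apply: leq_trans le_j (leq_subr _ _).
by rewrite subSS subnDA subKn // -!subnDA addnC.
Qed.

(** Modulo [c ^+ n.+1], [flat_eval] turns [fps_mul] into the product of [B]; such multiples do not
    affect the digit of order [n], so associativity of [B] carries over. *)
Lemma flat_mulA (a b d : nat -> A) :
  fps_mul flat_mul (fps_mul flat_mul a b) d
    =1 fps_mul flat_mul a (fps_mul flat_mul b d).
Proof.
move=> n; rewrite -!(flat_coef_mul _ _ (ltnSn n)).
have evalM u v : exists w, flat_eval n.+1 (fps_mul flat_mul u v) =
    flat_eval n.+1 u * flat_eval n.+1 v - c ^+ n.+1 * w.
  exists (iter n.+1 D (flat_eval n.+1 u * flat_eval n.+1 v)).
  rewrite -flat_eval_coef; apply: eq_bigr => i _.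
  by rewrite -(flat_coef_mul _ _ (ltn_ord i)).
have [w ->] := evalM a b; have [w' ->] := evalM b d.
have coef0 x : flat_coef n (c ^+ n.+1 * x) = 0 by rewrite flat_coefX ltnn.
rewrite mulrBl mulrBr !linearB /= -(mulrA (c ^+ _)) coef0.
rewrite [flat_eval _ a * (c ^+ _ * _)]mulrA central_exprC.
by rewrite -(mulrA (c ^+ _)) coef0 mulrA.
Qed.

Lemma flat_deformation : formal_deformation flat_mul.
Proof.
split=> [r b k x y|r a k x y|a b|]; last exact: flat_mulA.
- by rewrite /flat_mul linearP mulrDl -scalerAl linearP.
- by rewrite /flat_mul linearP mulrDr -scalerAr linearP.
- by rewrite /flat_mul /flat_coef /= pM !sK.
Qed.

(* The order-one part of a trivialization corrects [p \o D] to a derivation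
   along [p]. *)
Lemma flat_rigid_derivation : rigid A ->
  exists f : B -> A, [/\ linear f, f c = 1 &
    forall u v, f (u * v) = p u * f v + f u * p v].
Proof.
move=> /(_ _ flat_deformation).
case/(trivial_deformation_order1 flat_deformation) => phi phil phiM.
have phi0 : phi 0 = 0.
  by have := phil (-1) 0 0; rewrite scaler0 addr0 scaleN1r addNr.
exists (fun w => p (D w) + phi (p w)); split.
- move=> k u v; rewrite !linearP phil scalerDr addrACA.
  by congr (_ + _ + _).
- by rewrite pc phi0 addr0 -[c]mulr1 DK.
move=> u v; have uE w : w = s (p w) + c * D w by rewrite sp subrK.
(* Under [p \o D] the first summand gives [flat_mul 1 (p u) (p v)] and the second the Leibniz terms
   of [p \o D]. By [phiM], the former plus [phi (p u * p v)] yields the Leibniz terms of [phi]. *)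
have uvE : u * v = s (p u) * s (p v) + c * (D u * v + s (p u) * D v).
  rewrite mulrDr [c * (s _ * _)]mulrA -(cC (s (p u))) -[_ * c * D v]mulrA.
  by rewrite addrCA -mulrDr -uE mulrA -mulrDl addrC -uE.
rewrite {1}uvE pM !linearD /= DK linearD /= !pM sK.
rewrite -[p (D (_ * _))]/(flat_mul 1 (p u) (p v)) addrAC phiM mulrDr mulrDl.
by rewrite [RHS]addrACA [RHS]addrC [p (D u) * _ + _]addrC.
Qed.

End FlatDeformation.

(** * The central extension defined by a cocycle *)

Section CentralExtension.
Variables (K : fieldType) (g : lieAlgType K) (w : g -> g -> K).
Hypothesis wZ : is_cocycle2 w.

(** The cocycle proof is a parameter of the type so that the Lie structure, whose axioms rest on it,
    can be attached. *)
Definition cext of is_cocycle2 w : Type := (g * K^o)%type.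
Local Notation gh := (cext wZ).

HB.instance Definition _ := GRing.Lmodule.copy gh (g * K^o)%type.

Definition cext_lie (x y : gh) : gh := (lie x.1 y.1, w x.1 y.1).

Let wl z : scalar (w ^~ z). Proof. by case: wZ => [[]]. Qed.
Let wr z : scalar (w z). Proof. by case: wZ => [[]]. Qed.
Let w_alt x : w x x = 0. Proof. by case: wZ => [[]]. Qed.

Lemma cocycle2C x y : w x y = - w y x.
Proof.
have wDl p q r : w (p + q) r = w p r + w q r.
  by have := wl r 1 p q; rewrite scale1r mul1r.
have wDr p q r : w r (p + q) = w r p + w r q.
  by have := wr r 1 p q; rewrite scale1r mul1r.
apply/eqP; rewrite -addr_eq0; apply/eqP; have := w_alt (x + y).
by rewrite wDl !wDr !w_alt add0r addr0.
Qed.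

Lemma cocycle2_0l y : w 0 y = 0.
Proof.
by have := wl y (-1) 0 0; rewrite scaler0 addr0 mulN1r addNr.
Qed.

Fact cext_lie_linearl z : linear (cext_lie ^~ z).
Proof.
by move=> k x y; rewrite /cext_lie /= lie_linearl wl.
Qed.

Fact cext_lie_linearr z : linear (cext_lie z).
Proof.
by move=> k x y; rewrite /cext_lie /= lie_linearr wr.
Qed.

Fact cext_lie_alt x : cext_lie x x = 0.
Proof. by rewrite /cext_lie lie_alt w_alt. Qed.

(** In the second component the Jacobi identity is the cocycle condition, up to antisymmetry. *)
Fact cext_lie_jacobi x y z :
  cext_lie x (cext_lie y z) + cext_lie y (cext_lie z x)
  + cext_lie z (cext_lie x y) = 0.
Proof.
apply: (congr2 pair); rewrite /cext_lie /=; first exact: lie_jacobi.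
have wN p q : w p (- q) = - w p q.
  have wr0 : w p 0 = 0 by rewrite cocycle2C cocycle2_0l oppr0.
  by have := wr p (-1) q 0; rewrite addr0 scaleN1r mulN1r wr0 addr0.
rewrite -[RHS](wZ.2 x.1 y.1 z.1) /ce_d2.
rewrite [w (lie x.1 y.1) _]cocycle2C [w (lie x.1 z.1) _]cocycle2C.
rewrite [w (lie y.1 z.1) _]cocycle2C !opprK [lie x.1 z.1]lieC wN opprK.
by rewrite [LHS]addrC [X in _ + X = _]addrC addrA.
Qed.

HB.instance Definition _ := Lmodule_isLieAlgebra.Build K gh
  cext_lie_linearl cext_lie_linearr cext_lie_alt cext_lie_jacobi.

Local Notation U := (enveloping g).
Local Notation Uh := (enveloping gh).
Local Notation F := {malg K[{fmonom g}]}.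

Definition cext_inl (x : g) : gh := (x, 0).
Definition cext_c : Uh := env_in ((0, 1) : gh).

Lemma env_in_cext (x : gh) :
  env_in x = env_in (cext_inl x.1) + (x.2 : K) *: cext_c :> Uh.
Proof.
rewrite -env_inZ -env_inD; congr env_in; case: x => x k.
apply: (congr2 pair) => /=; first by rewrite scaler0 addr0.
by rewrite add0r [RHS]mulr1.
Qed.

Lemma cext_cC (u : Uh) : u * cext_c = cext_c * u.
Proof.
move: u; apply: enveloping_ind.
- by rewrite mul0r mulr0.
- by move=> u v uC vC; rewrite mulrDl mulrDr uC vC.
- by move=> k u uC; rewrite -scalerAl -scalerAr uC.
- by rewrite mul1r mulr1.
move=> x u uC; rewrite -mulrA uC !mulrA; congr (_ * _).
apply/esym/eqP; rewrite -subr_eq0 -env_in_lie.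
have -> : lie ((0, 1) : gh) x = 0 :> gh.
  apply: (congr2 pair) => /=; last exact: cocycle2_0l.
  by have := lie_linearl x.1 (-1) 0 0; rewrite scaler0 addr0 scaleN1r addNr.
by rewrite env_in0.
Qed.

(** As [cext_c] is central, this is the two-sided ideal it generates. *)
Definition cext_dvd (u : Uh) : Prop := exists v, u = cext_c * v.

Lemma cext_dvdD u v : cext_dvd u -> cext_dvd v -> cext_dvd (u + v).
Proof. by move=> [u' ->] [v' ->]; exists (u' + v'); rewrite mulrDr. Qed.

Lemma cext_dvdZ k u : cext_dvd u -> cext_dvd (k *: u).
Proof. by move=> [u' ->]; exists (k *: u'); rewrite -scalerAr. Qed.

Lemma cext_dvdMl u v : cext_dvd v -> cext_dvd (u * v).
Proof. by move=> [v' ->]; exists (u * v'); rewrite mulrA cext_cC mulrA. Qed.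

Lemma cext_dvdMr u v : cext_dvd u -> cext_dvd (u * v).
Proof. by move=> [u' ->]; exists (u' * v); rewrite mulrA. Qed.

Lemma cext_dvd0 : cext_dvd 0.
Proof. by exists 0; rewrite mulr0. Qed.

(** The lift lives on the free algebra because [cext_inl] need not preserve brackets; it descends to
    the enveloping algebra of [g] only modulo [cext_c]. *)
Definition cext_lift : F -> Uh := free_eval (fun x => env_in (cext_inl x)).

Lemma cext_lift0 : cext_lift 0 = 0.
Proof. exact: free_eval0. Qed.

Lemma cext_lift1 : cext_lift 1 = 1.
Proof. exact: free_eval1. Qed.

Lemma cext_liftD u v : cext_lift (u + v) = cext_lift u + cext_lift v.
Proof. exact: free_evalD. Qed.

Lemma cext_liftB u v : cext_lift (u - v) = cext_lift u - cext_lift v.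
Proof. exact: free_evalB. Qed.

Lemma cext_liftM u v : cext_lift (u * v) = cext_lift u * cext_lift v.
Proof. exact: free_evalM. Qed.

Lemma cext_liftZ k u : cext_lift (k *: u) = k *: cext_lift u.
Proof. exact: free_evalZ. Qed.

Lemma cext_lift_gen x : cext_lift (free_gen x) = env_in (cext_inl x).
Proof. exact: free_eval_gen. Qed.

Lemma cext_lie_inl x y :
  env_in (lie (cext_inl x) (cext_inl y)) =
  env_in (cext_inl (lie x y)) + w x y *: cext_c :> Uh.
Proof. exact: env_in_cext. Qed.

(** Linear relations lift exactly, and the bracket relation of [x] and [y] lifts with error
    [w x y *: cext_c]. *)
Lemma cext_lift_ideal u : env_ideal u -> cext_dvd (cext_lift u).
Proof.
elim=> {u} [k x y|x y||u v _ IHu _ IHv|u v _ IHv|u v _ IHu].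
- rewrite cext_liftB cext_liftD cext_liftZ 3!cext_lift_gen -env_inZ -env_inD.
  have -> : cext_inl (k *: x + y) = k *: cext_inl x + cext_inl y.
    by apply: (congr2 pair) => //=; rewrite scaler0 addr0.
  by rewrite subrr; apply: cext_dvd0.
- have liftB u v t : cext_lift (u - v - t) =
      cext_lift u - cext_lift v - cext_lift t by rewrite 2!cext_liftB.
  have liftg p q : cext_lift (free_gen p * free_gen q) =
      env_in (cext_inl p) * env_in (cext_inl q).
    by rewrite cext_liftM 2!cext_lift_gen.
  exists (w x y *: 1); apply: (etrans (liftB _ _ _)).
  apply: (etrans (congr2 (fun u v => u - v - _) (liftg x y) (liftg y x))).
  apply: (etrans (congr1 (fun u => u - _) (esym (env_in_lie _ _)))).
  rewrite cext_lie_inl cext_lift_gen addrC addKr.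
  by rewrite -scalerAr mulr1.
- by rewrite cext_lift0; apply: cext_dvd0.
- by rewrite cext_liftD; exact: cext_dvdD IHu IHv.
- by rewrite cext_liftM; exact: cext_dvdMl IHv.
- by rewrite cext_liftM; exact: cext_dvdMr IHu.
Qed.

(** * The projection modulo the central element and its linear section *)

Section Projection.
Variable p : {linear Uh -> U}.
Hypothesis p1 : p 1 = 1.
Hypothesis pM : {morph p : u v / u * v}.
Hypothesis p_in : forall x, p (env_in x) = env_in x.1.

Lemma cext_pc : p cext_c = 0.
Proof. by rewrite p_in env_in0. Qed.

Lemma cext_liftK u : p (cext_lift u) = \pi_U u.
Proof.
move: u; apply: free_alg_ind => [|u v IHu IHv|k u IHu||x u IHu].
- by rewrite cext_lift0 linear0.
- rewrite cext_liftD linearD.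
  exact: (etrans (congr2 +%R IHu IHv) (esym (env_piD _ _))).
- rewrite cext_liftZ linearZ.
  exact: (etrans (congr1 ( *:%R k) IHu) (esym (env_piZ _ _))).
- by rewrite cext_lift1 p1.
- rewrite cext_liftM pM cext_lift_gen p_in.
  exact: (etrans (congr1 ( *%R _) IHu) (esym (env_piM _ _))).
Qed.

(** Modulo [cext_c], each generator of the extension is the lift of its first component. *)
Lemma cext_lift_approx v :
  exists2 u, p v = \pi_U u & cext_dvd (v - cext_lift u).
Proof.
move: v; apply: enveloping_ind =>
  [|v v' [u pu du] [u' pu' du']|k v [u pu du]||].
- exists 0; first by rewrite linear0.
  by rewrite cext_lift0 subrr; apply: cext_dvd0.
- exists (u + u').
    rewrite linearD.
    exact: (etrans (congr2 +%R pu pu') (esym (env_piD _ _))).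
  by rewrite cext_liftD opprD addrACA; exact: cext_dvdD du du'.
- exists (k *: u).
    rewrite linearZ.
    exact: (etrans (congr1 ( *:%R k) pu) (esym (env_piZ _ _))).
  by rewrite cext_liftZ -scalerBr; exact: cext_dvdZ du.
- exists 1; first by rewrite p1.
  by rewrite cext_lift1 subrr; apply: cext_dvd0.
move=> x v [u pu du]; exists (free_gen x.1 * u).
  rewrite pM p_in; exact: (etrans (congr1 ( *%R _) pu) (esym (env_piM _ _))).
have splitE (X Y l : Uh) : (X + Y) * v - X * l = X * (v - l) + Y * v.
  by rewrite mulrDl mulrBr addrAC.
rewrite cext_liftM cext_lift_gen [env_in x]env_in_cext splitE.
apply: cext_dvdD; first exact: cext_dvdMl du.
by rewrite -scalerAl; apply: cext_dvdZ; exists v.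
Qed.

Variable D : {linear Uh -> Uh}.
Hypothesis DK : forall u, D (cext_c * u) = u.

(** This projects onto the kernel of [D] along the multiples of [cext_c], selecting one
    representative of each class modulo [cext_c]. *)
Definition cext_red (u : Uh) : Uh := u - cext_c * D u.

Lemma cext_red_linear : linear cext_red.
Proof.
move=> k u v; rewrite /cext_red linearP mulrDr -scalerAr scalerBr.
by rewrite opprD addrACA.
Qed.

Lemma cext_red_dvd u v : cext_dvd (u - v) -> cext_red u = cext_red v.
Proof.
move=> [t uv]; have -> : u = 1 *: (cext_c * t) + v by rewrite scale1r -uv subrK.
by rewrite cext_red_linear {1}/cext_red DK subrr scaler0 add0r.
Qed.

Definition cext_section (a : U) : Uh := cext_red (cext_lift (repr a)).

Lemma cext_section_pi u : cext_section (\pi_U u) = cext_red (cext_lift u).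
Proof.
apply: cext_red_dvd; rewrite -cext_liftB.
exact/cext_lift_ideal/env_reprB.
Qed.

Lemma cext_section_linear : linear cext_section.
Proof.
move=> k; do 2![elim/quotW=> ?]; rewrite -env_piZ -env_piD !cext_section_pi.
by rewrite cext_liftD cext_liftZ cext_red_linear.
Qed.

Lemma cext_sectionK a : p (cext_section a) = a.
Proof.
rewrite /cext_section /cext_red linearB pM cext_pc mul0r subr0.
by rewrite cext_liftK reprK.
Qed.

Lemma cext_section_proj v : cext_section (p v) = v - cext_c * D v.
Proof.
have [u -> dv] := cext_lift_approx v.
by rewrite cext_section_pi; apply/esym/cext_red_dvd.
Qed.

End Projection.

End CentralExtension.

(** * Projection, augmentation and division for the extension *)

Lemma cext_projection (K : fieldType) (g : lieAlgType K) (w : g -> g -> K)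
    (wZ : is_cocycle2 w) :
  exists p : {linear enveloping (cext wZ) -> enveloping g},
    [/\ p 1 = 1, {morph p : u v / u * v} & forall x, p (env_in x) = env_in x.1].
Proof.
have f_linear : linear (fun x : cext wZ => env_in x.1).
  by move=> k x y; rewrite -env_in_linear.
have f_lie (x y : cext wZ) : env_in (lie x y).1 =
    env_in x.1 * env_in y.1 - env_in y.1 * env_in x.1.
  exact: env_in_lie.
have [p [[pl [p1 pM] p_in] _]] := env_universal f_linear f_lie.
pose q : {linear enveloping (cext wZ) -> enveloping g} :=
  HB.pack p (GRing.isLinear.Build K _ _ *:%R p pl).
by exists q.
Qed.

Lemma augmentation (K : fieldType) (g : lieAlgType K) :
  exists e : enveloping g -> K, [/\ scalar e, e 1 = 1,
    {morph e : u v / u * v} & forall x, e (env_in x) = 0].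
Proof.
have z_linear : linear (fun _ : g => 0 : K^o).
  by move=> k x y; rewrite scaler0 addr0.
have z_lie (x y : g) : 0 = 0 * 0 - 0 * 0 :> K^o by rewrite mul0r subr0.
have [e [[el [e1 eM] e_in] _]] := env_universal z_linear z_lie.
by exists e; split.
Qed.

Lemma cext_division (K : fieldType) (g : finLieAlgType K) (w : g -> g -> K)
    (wZ : is_cocycle2 w) :
  exists D : {linear enveloping (cext wZ) -> enveloping (cext wZ)},
    forall u, D (cext_c wZ * u) = u.
Proof.
pose n := \dim (fullv : {vspace g}); pose X := vbasis (fullv : {vspace g}).
(* The central vector takes index 0, the least letter, as [pbw_divK] demands; a basis of [g]
   follows. *)
pose b (i : 'I_n.+1) : cext wZ :=
  if unlift ord0 i is Some j then (X`_j, 0) else (0, 1).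
pose co (i : 'I_n.+1) (x : cext wZ) : K :=
  if unlift ord0 i is Some j then coord X j x.1 else x.2.
have co_linear i : scalar (co i).
  move=> k x y; rewrite /co; case: unliftP => [j _|_] //=.
  by rewrite linearP.
have co_basis i j : co i (b j) = (i == j)%:R.
  rewrite /co /b; case: (unliftP ord0 i) => [i' ->|->];
    case: (unliftP ord0 j) => [j' ->|->] //=.
  - rewrite coord_free ?(basis_free (vbasisP _)) //.
    by rewrite (inj_eq lift_inj) eq_sym.
  - by rewrite linear0.
have basis_co x : x = \sum_i co i x *: b i.
  have sumE : \sum_(j < n) coord X j x.1 *: ((X`_j, 0) : cext wZ) = (x.1, 0).
    rewrite {2}(coord_vbasis (memvf x.1)).
    elim/big_rec2: _ => // j y z _ ->.
    by apply: (congr2 pair) => //=; rewrite scaler0 addr0.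
  rewrite big_ord_recl /co /b unlift_none.
  under eq_bigr do rewrite liftK.
  rewrite [X in _ + X]sumE; case: x {sumE} => x k.
  apply: (congr2 pair) => /=; first by rewrite scaler0 add0r.
  by rewrite addr0 [RHS]mulr1.
pose D := pbw_div b co (malg_free_lmod K (seq 'I_n.+1)) ord0.
have Dl : linear D by exact: pbw_div_linear.
pose DL : {linear enveloping (cext wZ) -> enveloping (cext wZ)} :=
  HB.pack D (GRing.isLinear.Build K _ _ *:%R D Dl).
exists DL => u /=.
have -> : cext_c wZ = env_in (b ord0) by rewrite /b unlift_none.
exact: pbw_divK.
Qed.

(** * From rigidity to the vanishing of cocycle classes *)

Lemma rigid_cocycle2_coboundary (K : fieldType) (g : finLieAlgType K)
    (w : g -> g -> K) :
  strongly_rigid g -> is_cocycle2 w -> is_coboundary2 w.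
Proof.
move=> rig wZ; have [p [p1 pM p_in]] := cext_projection wZ.
have [D DK] := cext_division wZ.
have [e [el e1 eM e_in]] := augmentation g.
pose s : {linear enveloping g -> enveloping (cext wZ)} :=
  HB.pack (cext_section D)
    (GRing.isLinear.Build K _ _ *:%R _ (cext_section_linear DK)).
have [f [fl fc fM]] := flat_rigid_derivation (s := s) pM p1 (cext_pc p_in)
  (@cext_cC _ _ _ wZ) DK (cext_sectionK p1 pM p_in D)
  (cext_section_proj p1 pM p_in DK) rig.
pose a x := e (f (env_in (cext_inl wZ x))).
exists a.
  move=> k x y; rewrite /a.
  have -> : cext_inl wZ (k *: x + y) = k *: cext_inl wZ x + cext_inl wZ y.
    by apply: (congr2 pair) => //=; rewrite scaler0 addr0.
  by rewrite env_in_linear fl el.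
move=> x y; rewrite /ce_d1 /a; apply/esym/eqP; rewrite eqr_oppLR; apply/eqP.
have eP k u v : e (k *: u + v) = k * e u + e v by exact: el.
have eD u v : e (u + v) = e u + e v.
  by have := eP 1 u v; rewrite scale1r mul1r.
have epin (z : g) : e (p (env_in (cext_inl wZ z))) = 0 by rewrite p_in e_in.
have efM z t : e (f (env_in (cext_inl wZ z) * env_in (cext_inl wZ t))) = 0.
  by rewrite fM eD !eM !epin mul0r mulr0 addr0.
(* The commutator side vanishes by [efM], and [f] sends the central element to 1. What remains is
   [0 = a (lie x y) + w x y], which matches the sign in [ce_d1]. *)
have := congr1 (e \o f) (cext_lie_inl wZ x y).
rewrite env_in_lie /= [X in e (f X) = _]addrC -scaleN1r fl eP !efM mulr0 addr0.
rewrite [X in f X]addrC fl eP fc e1 mulr1 => /esym/eqP.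
by rewrite addrC addr_eq0 => /eqP.
Qed.

Theorem mainTheorem3 (K : closedFieldType) (charK : [pchar K]%R =i pred0)
    (g : finLieAlgType K) (H2 : ce_H2_nonzero g) :
  ~ strongly_rigid g.
Proof.
move=> rig; case: H2 => w wZ; apply.
exact: rigid_cocycle2_coboundary.
Qed.
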